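(* Let $X$ be a proper metric space and let $Y\subset X$ be a closed subset, equipped with the restricted metric. Then $\operatorname{asInd} Y\le \operatorname{asInd} X$.
   Context: A metric space $(X,d)$ is proper if every closed ball is compact. A base point $x_0\in X$ is fixed in each (nonempty) proper metric space; $B_r(x)$ is the open ball of radius $r$ around $x$. Distances between sets are infima, with $d(\emptyset,\cdot)=\infty$. Two subsets $A_1,A_2\subset X$ are asymptotically disjoint if $\lim_{r\to\infty} d(A_1\setminus B_r(x_0),A_2\setminus B_r(x_0))=\infty$. A map $\phi:X\to[0,1]$ is slowly oscillating if for every $r>0$ and $\varepsilon>0$ there is $D>0$ such that $\operatorname{diam}\phi(B_r(x))<\varepsilon$ for all $x$ with $d(x,x_0)\ge D$. Let $C_h(X)$ be the set of all continuous slowly oscillating functions $X\to[0,1]$. The Higson compactification $cX$ is the closure of the image of $X$ under the embedding $X\to[0,1]^{C_h(X)}$, $x\mapsto(\phi(x))_{\phi\in C_h(X)}$; the Higson corona is $\nu X=cX\setminus X$. For $C\subset X$ put $C'=\operatorname{cl}_{cX}(C)\cap\nu X$. A partition between disjoint closed subsets $F_1,F_2$ of a topological space $T$ is a subset $P\subset T$ such that $T\setminus P=U_1\cup U_2$ with $U_1,U_2$ disjoint open subsets of $T$, $F_1\subset U_1$, $F_2\subset U_2$. For asymptotically disjoint $A_1,A_2\subset X$, a closed subset $C\subset X$ is an asymptotic separator for $A_1$ and $A_2$ if $C'$ is a partition between $A_1'$ and $A_2'$ in $\nu X$. The dimension $\operatorname{asInd}$ is defined for proper metric spaces inductively (closed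 subsets of proper metric spaces are proper metric spaces with the restricted metric): $\operatorname{asInd}X=-1$ iff $X$ is bounded (the empty set counts as bounded); for an integer $n\ge 0$, $\operatorname{asInd}X\le n$ if for every two asymptotically disjoint sets $A,B\subset X$ there is an asymptotic separator $C$ for $A$ and $B$ with $\operatorname{asInd}C\le n-1$. $\operatorname{asInd}X=n$ if $\operatorname{asInd}X\le n$ and not $\operatorname{asInd}X\le n-1$; $\operatorname{asInd}X=\infty$ if $\operatorname{asInd}X\le n$ holds for no $n$. *)

(* Defs.v *)
From HB Require Import structures.
From mathcomp Require Import all_boot all_order all_algebra.
From mathcomp Require Import all_classical all_reals all_analysis.

Set Implicit Arguments.
Unset Strict Implicit.
Unset Printing Implicit Defensive.

Import Order.TTheory GRing.Theory Num.Theory.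
Import numFieldNormedType.Exports.

Local Open Scope classical_set_scope.
Local Open Scope ring_scope.

(* The restricted metric on a subset; the library already provides the
   corresponding topology and balls on [set_type A]. *)
Section set_type_metric.
Context {R : realType} {X : metricType R} (A : set X).

Let dist (x y : set_type A) : R := mdist (set_val x) (set_val y).

Let dist_ge0 x y : 0 <= dist x y.
Proof. exact: mdist_ge0. Qed.

Let dist_positivity x y : dist x y = 0 -> x = y.
Proof. by move=> /mdist_positivity /val_inj. Qed.

Let ballEdist (x : set_type A) d : ball x d = [set y | dist x y < d].
Proof.
rewrite /ball /= /initial_ball ballEmdist.
by apply/seteqP; split.
Qed.

HB.instance Definition _ :=
  @PseudoMetric_isMetric.Build R (set_type A) dist dist_ge0 dist_positivity
    ballEdist.

End set_type_metric.

(* The closed ball is written out: the library's [closed_ball] is the closure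
   of the open ball, which may be smaller. *)
Definition proper_metric (R : realType) (X : metricType R) : Prop :=
  forall (x : X) (r : R), compact [set y | mdist x y <= r].

Definition bounded_metric (R : realType) (X : metricType R) : Prop :=
  exists M : R, forall x y : X, mdist x y <= M.

(* The fixed base point, chosen classically; [None] for the empty space. *)
Definition base_point (X : Type) : option X :=
  match pselect (exists x : X, True) with
  | left ex => Some (sval (cid ex))
  | right _ => None
  end.

Section higson.
Context {R : realType}.
Implicit Type X : metricType R.

(* B_r(x_0) *)
Definition base_ball X (r : R) : set X :=
  if base_point X is Some x0 then ball x0 r else set0.
Arguments base_ball : clear implicits.

(* Equals +oo as soon as one of the sets is empty. *)
Definition set_dist X (A B : set X) : \bar R :=
  ereal_inf [set (mdist x y)%:E | x in A & y in B].

Definition asymptotically_disjoint X (A B : set X) : Prop :=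
  set_dist (A `\` base_ball X r) (B `\` base_ball X r) @[r --> +oo%R]
    --> +oo%E.

Definition diam (A : set R) : \bar R :=
  ereal_sup [set `|x - y|%:E | x in A & y in A].

Definition unit_interval : topologicalType := set_type (`[0, 1] : set R).

Definition slowly_oscillating X (phi : X -> unit_interval) : Prop :=
  forall r e : R, 0 < r -> 0 < e -> exists2 D : R, 0 < D &
    forall x, ~ base_ball X D x ->
      (diam [set set_val (phi y) | y in ball x r] < e%:E)%E.

(* C_h(X) *)
Definition Higson_fun X : Type :=
  {phi : X -> unit_interval | continuous phi /\ slowly_oscillating phi}.

HB.instance Definition _ X := gen_eqMixin (Higson_fun X).
HB.instance Definition _ X := gen_choiceMixin (Higson_fun X).

(* [0,1]^{C_h(X)} *)
Definition Higson_cube X : topologicalType :=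
  prod_topology (fun _ : Higson_fun X => unit_interval).

Definition Higson_embed X (x : X) : Higson_cube X := fun phi => sval phi x.

Definition Higson_compactification X : set (Higson_cube X) :=
  closure (range (@Higson_embed X)).

(* As a topological space, the corona is [set_type (Higson_corona X)], with the
   subspace topology. *)
Definition Higson_corona X : set (Higson_cube X) :=
  @Higson_compactification X `\` range (@Higson_embed X).

(* C'. The compactification is closed in the cube, so the closure of C can be
   taken in the cube. *)
Definition corona_trace X (C : set X) : set (set_type (@Higson_corona X)) :=
  [set p | closure (@Higson_embed X @` C) (set_val p)].

End higson.

Arguments base_ball {R} X r.

Definition partition_between (T : topologicalType) (F1 F2 P : set T) : Prop :=
  exists U1 U2 : set T,
    [/\ open U1, open U2, U1 `&` U2 = set0, ~` P = U1 `|` U2 &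
        F1 `<=` U1 /\ F2 `<=` U2].

Definition asymptotic_separator (R : realType) (X : metricType R)
    (A B C : set X) : Prop :=
  closed C /\
  partition_between (corona_trace A) (corona_trace B) (corona_trace C).

(* [asInd_lt k X] is "asInd X <= k - 1"; the shift lets the recursion, which
   starts at -1, run over [nat]. *)
Fixpoint asInd_lt (R : realType) (k : nat) (X : metricType R) : Prop :=
  match k with
  | 0%N => bounded_metric X
  | k'.+1 => forall A B : set X, asymptotically_disjoint A B ->
      exists2 C : set X, asymptotic_separator A B C &
        asInd_lt k' (set_type C : metricType R)
  end.

Definition asInd_le (R : realType) (X : metricType R) (n : int) : Prop :=
  match n with
  | Posz k => asInd_lt k.+1 X
  | Negz 0 => asInd_lt 0 X
  | Negz _.+1 => False
  end.

(* [xget] selects the n such that asInd X <= n but not asInd X <= n - 1, and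
   returns +oo if asInd X <= n for no n. *)
Definition asInd (R : realType) (X : metricType R) : \bar int :=
  xget +oo%E [set n%:E%E | n in [set n : int |
                             asInd_le X n /\ ~ asInd_le X (n - 1)]].

(* Main.v *)
Require Import Defs.
From HB Require Import structures.
From mathcomp Require Import all_boot all_order all_algebra.
From mathcomp Require Import all_classical all_reals all_analysis.
From mathcomp Require Import ring lra zify.

Import Order.TTheory GRing.Theory Num.Theory.
Import numFieldNormedType.Exports.

Local Open Scope classical_set_scope.
Local Open Scope ring_scope.

(* The trace of a separator C of X on the corona of Y need not be the trace of
   a subset of C, since C may stay close to Y without meeting it, at distances
   that are not bounded.  A separator in Y is obtained instead by taking, for
   each n, the set of points of Y at distance at most n + 1 from C and far from
   the base point, and a net of it whose mesh t_n is large compared to n.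
   Thinned out and put together, these nets form a set D such that
   - sending a point of D to a nearby point of C is bi-Lipschitz, as distances
     in D dominate the displacement;
   - D comes within bounded distance of every point of Y that is far out and at
     bounded distance from C, so the trace of D contains the part of the trace
     of C that lies in the corona of Y.
   This forces the induction to run over bi-Lipschitz embeddings rather than
   over inclusions. *)

Set Implicit Arguments.
Unset Strict Implicit.
Unset Printing Implicit Defensive.

(** * Metric reformulation of the asymptotic notions *)

Lemma compact_set_type (T : topologicalType) (A : set T) (K : set (set_type A)) :
  compact (set_val @` K) -> compact K.
Proof.
move=> cK F PF FK.
have [|_ [[x Kx <-] clx]] := cK (set_val @ F) (fmap_proper_filter _ PF).
  by rewrite nbhs_simpl /=; apply: filterS FK => x Kx; exists x.
exists x; split=> // P U FP [_ [[V oV <-] Vx] VU].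
have FP' : (set_val @ F) (set_val @` P).
  by rewrite nbhs_simpl /=; apply: filterS FP => y Py; exists y.
have [_ [[y Py <-] Vy]] := clx _ _ FP' (open_nbhs_nbhs (conj oV Vx)).
by exists y; split=> //; exact: VU.
Qed.

Lemma hausdorff_set_type (T : topologicalType) (A : set T) :
  hausdorff_space T -> hausdorff_space (set_type A).
Proof.
move=> hT x y clxy; apply: val_inj; apply: hT => U V.
rewrite nbhsE => -[U' [oU' U'x] U'U]; rewrite nbhsE => -[V' [oV' V'y] V'V].
have nU : nbhs x (set_val @^-1` U').
  by apply: open_nbhs_nbhs; split => //; exists U'.
have nV : nbhs y (set_val @^-1` V').
  by apply: open_nbhs_nbhs; split => //; exists V'.
have [z [Uz Vz]] := clxy _ _ nU nV.
by exists (set_val z); split; [exact: U'U|exact: V'V].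
Qed.

Section metric.
Context {R : realType}.

Lemma proper_set_type (X : metricType R) (A : set X) :
  proper_metric X -> closed A -> proper_metric (set_type A : metricType R).
Proof.
move=> pX cA x r; apply: compact_set_type.
have -> : set_val @` [set y : set_type A | mdist x y <= r] =
    [set y | mdist (set_val x) y <= r] `&` A.
  apply/seteqP; split => [_ [y /= xy <-]|y [/= xy Ay]].
    by split => //; exact: set_valP.
  by exists (exist _ y (mem_set Ay)).
exact: compact_closedI.
Qed.

Lemma compact_unit_interval : compact [set: @unit_interval R].
Proof.
apply: compact_set_type.
have -> : set_val @` [set: set_type (`[0, 1] : set R)] = `[0, 1]%classic.
  apply/seteqP; split => [_ [y _ <-]|y Ay]; first exact: set_valP.
  by exists (exist _ y (mem_set Ay)).
exact: segment_compact.
Qed.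

Lemma hausdorff_unit_interval : hausdorff_space (@unit_interval R).
Proof. exact/hausdorff_set_type/Rhausdorff. Qed.

(** * Distance to the base point, and pointwise criteria *)

Definition gauge (X : metricType R) (x : X) : R :=
  if base_point X is Some x0 then mdist x0 x else 0.

Lemma base_ballE (X : metricType R) (r : R) (x : X) :
  base_ball X r x <-> gauge x < r.
Proof.
rewrite /base_ball /gauge /base_point; case: pselect => [ex|]; last by case; exists x.
by rewrite ballEmdist.
Qed.

Lemma not_base_ballE (X : metricType R) (r : R) (x : X) :
  ~ base_ball X r x <-> r <= gauge x.
Proof.
split=> [h|h /base_ballE]; last by rewrite ltNge h.
by rewrite leNgt; apply/negP => /base_ballE.
Qed.

Lemma gauge_ge0 (X : metricType R) (x : X) : 0 <= gauge x.
Proof. by rewrite /gauge; case: base_point => // a; exact: mdist_ge0. Qed.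

Lemma gauge_le (X : metricType R) (x y : X) : gauge y <= gauge x + mdist x y.
Proof.
rewrite /gauge; case: base_point => [a|]; first exact: metric_triangle.
by rewrite add0r mdist_ge0.
Qed.

Lemma compact_gauge (X : metricType R) (r : R) :
  proper_metric X -> compact [set x : X | gauge x <= r].
Proof.
move=> pX; rewrite /gauge; case E: (base_point X) => [a|]; first exact: pX.
suff -> : [set x : X | 0 <= r] = set0 by exact: compact0.
apply/seteqP; split => // x _; move: E; rewrite /base_point.
by case: pselect => // -[]; exists x.
Qed.

Lemma lt_ereal_inf_set_dist (X : metricType R) (A B : set X) (M : R) :
  (M%:E < set_dist A B)%E -> forall a b, A a -> B b -> M < mdist a b.
Proof.
move=> MAB a b Aa Bb; rewrite -lte_fin; apply: (lt_le_trans MAB).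
by apply: ereal_inf_lbound; exists a => //; exists b.
Qed.

(** It suffices that [a] be far out: a point [b] within [M] of [a] is then far out too, up to the
    constant [M]. *)
Lemma asymptotically_disjointP (X : metricType R) (A B : set X) :
  asymptotically_disjoint A B <->
  forall M : R, exists r : R, forall a b, A a -> B b -> r <= gauge a ->
    mdist a b <= M -> False.
Proof.
split=> [/cvgeyPgt AB M|AB].
  have [r [_ /(_ (r + 1))]] := AB M.
  rewrite ltrDl ltr01 => /(_ isT) /lt_ereal_inf_set_dist h.
  exists (r + 1 + `|M|) => a b Aa Bb ra abM.
  have /h : (A `\` base_ball X (r + 1)) a.
    split => //; apply/not_base_ballE.
    by apply: le_trans ra; rewrite lerDl.
  have := gauge_le b a; rewrite metric_sym => ba.
  have /[swap]/[apply] : (B `\` base_ball X (r + 1)) b.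
    split => //; apply/not_base_ballE.
    have := ler_norm M; lra.
  by rewrite ltNge abM.
apply/cvgeyPge => M.
have [r h] := AB M.
exists r; split; first exact: num_real.
move=> s rs; apply: le_ereal_inf_tmp => _ [a [Aa /not_base_ballE sa] [b [Bb _] <-]].
rewrite lee_fin leNgt; apply/negP => /ltW; apply: h => //.
exact: le_trans (ltW rs) sa.
Qed.

Lemma asymptotically_disjoint_sym (X : metricType R) (A B : set X) :
  asymptotically_disjoint A B -> asymptotically_disjoint B A.
Proof.
move=> /asymptotically_disjointP AB; apply/asymptotically_disjointP => M.
have [r h] := AB M; exists (r + M) => b a Bb Aa rb; rewrite metric_sym => abM.
apply: (h _ _ Aa Bb _ abM).
by have := gauge_le a b; lra.
Qed.

Lemma slowly_oscillatingP (X : metricType R) (phi : X -> unit_interval) :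
  slowly_oscillating phi <->
  forall r e : R, 0 < e -> exists D : R, forall x y, D <= gauge x ->
    mdist x y <= r -> `|set_val (phi x) - set_val (phi y)| < e.
Proof.
split=> h r e.
  move=> e0; have [] := h (`|r| + 1) e _ e0; first by rewrite ltr_wpDl.
  move=> D D0 hD; exists D => x y Dx xy.
  rewrite -lte_fin; apply: le_lt_trans (hD x _); last exact/not_base_ballE.
  have r1 : r < `|r| + 1 by rewrite (le_lt_trans (ler_norm r))// ltrDl.
  apply: ereal_sup_ubound; exists (set_val (phi x)).
    by exists x => //; apply: ballxx; rewrite ltr_wpDl.
  by exists (set_val (phi y)) => //; exists y => //; rewrite ballEmdist/= (le_lt_trans xy).
(* Points of the ball are compared through its centre, so the diameter is at most 2e/3 and stays
   strictly below e after the supremum. *)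
move=> r0 e0; have [|D hD] := h r (e / 3); first by rewrite divr_gt0.
exists (Num.max D 1); first by rewrite lt_max ltr01 orbT.
move=> x /not_base_ballE; rewrite ge_max => /andP[Dx _].
apply: (@le_lt_trans _ _ (e / 3 * 2)%:E); last by rewrite lte_fin; lra.
apply: ge_ereal_sup => _ [_ [y xy <-] [_ [z xz <-] <-]].
rewrite lee_fin; move: xy xz; rewrite !ballEmdist/= => /ltW xy /ltW xz.
have := hD _ _ Dx xy; have := hD _ _ Dx xz.
set a := set_val (phi x); set b := set_val (phi y); set c := set_val (phi z).
by move: a b c => a b c; rewrite !ltr_norml !ler_norml; lra.
Qed.

End metric.

(** * The Higson compactification *)

Section compactification.
Context {R : realType}.
Implicit Types X : metricType R.

Lemma continuous_coord X (phi : Higson_fun X) :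
  continuous (fun p : Higson_cube X => p phi).
Proof.
exact: (@proj_continuous (Higson_fun X) (fun=> @unit_interval R) phi).
Qed.

Lemma continuous_cube (T : topologicalType) X (F : T -> Higson_cube X) :
  (forall phi, continuous (fun t => F t phi)) -> continuous F.
Proof.
move=> cF t; apply/cvg_sup => phi.
exact: (@continuous_comp_initial (Higson_cube X) _ _
  (fun p : Higson_cube X => p phi) F (cF phi) t).
Qed.

Lemma continuous_Higson_embed X : continuous (@Higson_embed R X).
Proof. by apply: continuous_cube => -[phi []]. Qed.

Lemma compact_cube X : compact [set: Higson_cube X].
Proof.
move=> F PF FT.
have cT := @tychonoff (Higson_fun X) _ _ (fun=> compact_unit_interval (R := R)).
have [|p [_ clp]] := cT F PF; last by exists p.
by apply: filterS FT.
Qed.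

Lemma hausdorff_cube X : hausdorff_space (Higson_cube X).
Proof.
exact: (@hausdorff_product (Higson_fun X) _ (fun=> hausdorff_unit_interval (R := R))).
Qed.

(** Supplies the test functions used on the cube: the Lipschitz bound gives continuity, the last
    hypothesis slow oscillation. *)
Lemma Higson_fun_lipschitz X (g : X -> R) (K : R) :
  (forall x, 0 <= g x <= 1) ->
  (forall x y, `|g x - g y| <= K * mdist x y) ->
  (forall r e : R, 0 < e -> exists D : R, forall x y, D <= gauge x ->
    mdist x y <= r -> `|g x - g y| < e) ->
  exists phi : Higson_fun X, forall x, set_val (sval phi x) = g x.
Proof.
move=> g01 gK gslow.
have g_in x : g x \in `[0, 1]%classic by rewrite inE /= in_itv /= g01.
pose phi x : unit_interval := exist _ (g x) (g_in x).
suff h : continuous phi /\ slowly_oscillating phi by exists (exist _ phi h).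
split; last exact/slowly_oscillatingP.
apply: continuous_comp_initial => x; apply/cvgrPdist_lt => e e0.
apply/nbhs_ballP; exists (e / (`|K| + 1)); first by rewrite /= divr_gt0// ltr_wpDl.
move=> y; rewrite ballEmdist /= ltr_pdivlMr ?ltr_wpDl// => xy.
apply: le_lt_trans (gK x y) _; apply: le_lt_trans xy.
rewrite mulrC ler_wpM2l ?mdist_ge0//.
by rewrite (le_trans (ler_norm K))// lerDl.
Qed.

Lemma nbhs_coord X (p : Higson_cube X) (phi : Higson_fun X) (e : R) :
  0 < e -> nbhs p [set q | `|set_val (p phi) - set_val (q phi)| < e].
Proof.
move=> e0.
have c : (set_val (q phi) : R) @[q --> p] --> (set_val (p phi) : R).
  apply: (@continuous_comp _ _ _ (fun q : Higson_cube X => q phi)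
    (set_val : unit_interval -> R)); first exact: continuous_coord.
  exact: initial_continuous.
by move/cvgrPdist_lt : c => /(_ e e0).
Qed.

(** Slow oscillation of single coordinates passes to all neighbourhoods in the cube: the sets [W]
    with the stated property form a filter, so it is enough to treat subbasic neighbourhoods, which
    depend on one coordinate. *)
Lemma nbhs_slow X (p : Higson_cube X) (W : set (Higson_cube X)) :
  nbhs p W -> exists2 V, nbhs p V & forall r : R, exists D : R, forall x y,
    D <= gauge x -> mdist x y <= r -> V (Higson_embed x) -> W (Higson_embed y).
Proof.
pose G : set_system (Higson_cube X) := [set W | exists2 V, nbhs p V &
  forall r : R, exists D : R, forall x y,
    D <= gauge x -> mdist x y <= r -> V (Higson_embed x) -> W (Higson_embed y)].
have FG : Filter G.
  split.
  - by exists setT; [exact: filterT|move=> r; exists 0].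
  - move=> A B [V pV hV] [V' pV' hV']; exists (V `&` V'); first exact: filterI.
    move=> r; have [D hD] := hV r; have [D' hD'] := hV' r.
    exists (Num.max D D') => x y; rewrite ge_max => /andP[Dx D'x] xy [Vx V'x].
    by split; [exact: hD xy Vx|exact: hD' xy V'x].
  - move=> A B AB [V pV hV]; exists V => // r; have [D hD] := hV r.
    by exists D => x y Dx xy Vx; apply: AB; exact: hD xy Vx.
suff Gp : G --> p by exact: Gp.
apply/cvg_sup => phi A [_ [[U oU <-] Up] UA].
have [e /= e0 eU] : nbhs_ball (p phi) U.
  by apply/nbhs_ballP/open_nbhs_nbhs; split.
have e20 : 0 < e / 2 by rewrite divr_gt0.
exists [set q | `|set_val (p phi) - set_val (q phi)| < e / 2].
  exact: nbhs_coord.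
move=> r; have /slowly_oscillatingP/(_ r _ e20)[D hD] := (svalP phi).2.
exists D => x y Dx xy /= px; apply: UA; apply: eU.
rewrite /ball /= /initial_ball /ball /=.
have := hD x y Dx xy; move: px; rewrite /Higson_embed.
move: (set_val (p phi)) (set_val (sval phi x)) (set_val (sval phi y)) => a b c.
by rewrite !ltr_norml; lra.
Qed.

End compactification.

(** * Asymptotic disjointness and traces on the corona *)

Section corona.
Context {R : realType}.
Implicit Types X : metricType R.

(** The points of gauge at most [r] form a compact set, whose image is closed in the cube and misses
    the corona point [p]. *)
Lemma closure_far X (p : Higson_cube X) (C : set X) (r : R) :
  proper_metric X -> Higson_corona p -> closure (@Higson_embed R X @` C) p ->
  closure (@Higson_embed R X @` (C `&` [set x | r <= gauge x])) p.
Proof.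
move=> pX [_ pNX].
pose K := @Higson_embed R X @` [set x | gauge x <= r].
have cK : closed K.
  apply: compact_closed; first exact: hausdorff_cube.
  apply: continuous_compact; last exact: compact_gauge.
  by apply: continuous_subspaceT; exact: continuous_Higson_embed.
have Kp : ~ K p by move=> [x _ xp]; apply: pNX; exists x.
move=> Cp W pW; have nK : nbhs p (~` K) by apply: open_nbhs_nbhs; split=> //; exact: closed_openC.
have [_ [[x Cx <-] [Wx Kx]]] := Cp _ (filterI pW nK).
exists (Higson_embed x); split=> //; exists x => //; split => //=.
by rewrite leNgt; apply/negP => /ltW xr; apply: Kx; exists x.
Qed.

(** If [p] came from a point [x] of [X], the bump function 1 - d(x, .), cut off at 0, would separate
    it from the far points: it is 1 at [x] and vanishes where the gauge is at least
    [gauge x + 1]. *)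
Lemma Higson_corona_far X (p : Higson_cube X) :
  (forall r : R, closure (@Higson_embed R X @` [set x | r <= gauge x]) p) ->
  Higson_corona p.
Proof.
move=> far; split.
  move=> W /(far 0) [_ [[x _ <-] Wx]].
  by exists (Higson_embed x); split=> //; exists x.
move=> [x _ xp].
have [|||phi phiE] := @Higson_fun_lipschitz R X
    (fun y => Num.max 0 (1 - mdist x y)) 1.
- by move=> y; rewrite le_max lexx /= ge_max ler01 /= gerBl mdist_ge0.
- move=> y z; rewrite mul1r.
  have := metric_triangle x y z; have := metric_triangle x z y.
  rewrite (metric_sym z y); move: (mdist x y) (mdist x z) (mdist y z) => a b c.
  have [h1|h1] := leP 0 (1 - a); have [h2|h2] := leP 0 (1 - b);
    by rewrite ler_norml; lra.
- move=> r e e0; exists (gauge x + 1 + `|r|) => y z Dy yz.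
  suff far' w : gauge x + 1 <= gauge w -> Num.max 0 (1 - mdist x w) = 0.
    have := gauge_le z y; rewrite (metric_sym z) => gzy.
    have := normr_ge0 r; have := ler_norm r => rr r0.
    by rewrite !far' ?subrr ?normr0//; lra.
  by move=> xw; apply/max_idPl; have := gauge_le x w; lra.
have /(_ _ (nbhs_coord p phi (e := 1) ltr01)) := far (gauge x + 1).
move=> [_ [[y /= xy <-] /=]]; rewrite -xp /Higson_embed !phiE.
rewrite mdistxx subr0 (max_idPr ler01) (max_idPl _) ?subr0 ?normr1 ?ltxx//.
by have := gauge_le x y; lra.
Qed.

(** * Distance to a set, and a function separating asymptotically disjoint sets *)

Definition dist_to X (A : set X) (x : X) : R := inf [set mdist x a | a in A].

Section dist_to.
Variables (X : metricType R) (A : set X).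
Hypothesis A0 : A !=set0.

Let has_infA x : has_inf [set mdist x a | a in A].
Proof.
split; first by case: A0 => a Aa; exists (mdist x a); exists a.
by exists 0 => _ [a _ <-]; exact: mdist_ge0.
Qed.

Lemma dist_to_ge0 x : 0 <= dist_to A x.
Proof. by apply: lb_le_inf => [|_ [a _ <-]]; [case: (has_infA x)|exact: mdist_ge0]. Qed.

Lemma dist_to_le x a : A a -> dist_to A x <= mdist x a.
Proof. by move=> Aa; apply: ge_inf; [case: (has_infA x)|exists a]. Qed.

Lemma dist_to_lt x (r : R) : dist_to A x < r -> exists2 a, A a & mdist x a < r.
Proof. by move=> /(inf_lt (has_infA x).1)[_ [a Aa <-] ?]; exists a. Qed.

Lemma dist_to_lipschitz x y : `|dist_to A x - dist_to A y| <= mdist x y.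
Proof.
suff h u v : dist_to A u <= dist_to A v + mdist u v.
  by rewrite ler_norml; have := h x y; have := h y x; rewrite (metric_sym y); lra.
apply/ler_addgt0Pl => e e0.
have [a Aa va] : exists2 a, A a & mdist v a < dist_to A v + e.
  by apply: dist_to_lt; rewrite ltrDl.
have := dist_to_le u Aa; have := metric_triangle u v a; lra.
Qed.

End dist_to.

(** Applied to the distances to two sets. The denominator 1 + u + v survives in the bound, and its
    growth makes the quotient oscillate slowly. *)
Lemma ratio_lipschitz (u v u' v' d : R) : 0 <= u -> 0 <= v -> 0 <= u' -> 0 <= v' ->
  `|u - u'| <= d -> `|v - v'| <= d ->
  `|u / (1 + u + v) - u' / (1 + u' + v')| <= 3 * d / (1 + u + v).
Proof.
move=> u0 v0 u'0 v'0 uu' vv'.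
have s0 : 0 < 1 + u + v by lra.
have s'0 : 0 < 1 + u' + v' by lra.
(* Over the common denominator the numerator is at most 3d(1 + u' + v'), so the primed factor
   cancels. *)
have -> : u / (1 + u + v) - u' / (1 + u' + v') =
    ((u - u') * (1 + u' + v') + u' * ((u' - u) + (v' - v))) /
    ((1 + u' + v') * (1 + u + v)).
  by field; rewrite !gt_eqF.
rewrite normrM normfV (gtr0_norm (mulr_gt0 s'0 s0)) invfM mulrA.
rewrite ler_pM2r ?invr_gt0// ler_pdivrMr//.
rewrite (le_trans (ler_normD _ _))// !normrM (gtr0_norm s'0) (ger0_norm u'0).
have h1 : `|u - u'| * (1 + u' + v') <= d * (1 + u' + v') by rewrite ler_pM2r.
have h2 : u' * `|u' - u + (v' - v)| <= u' * (2 * d).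
  rewrite ler_wpM2l// (le_trans (ler_normD _ _))//.
  by rewrite (distrC u') (distrC v'); lra.
have d0 : 0 <= d by exact: le_trans uu'.
have : 0 <= d * (1 + v') by rewrite mulr_ge0//; lra.
lra.
Qed.

(* The function [dist_to A / (1 + dist_to A + dist_to B)] vanishes on [A] and
   tends to 1 along [B]; it oscillates slowly because [dist_to A + dist_to B]
   tends to infinity. *)
Lemma asymptotically_disjoint_corona X (A B : set X) (p : Higson_cube X) :
  proper_metric X -> asymptotically_disjoint A B -> Higson_corona p ->
  closure (@Higson_embed R X @` A) p -> closure (@Higson_embed R X @` B) p ->
  False.
Proof.
move=> pX AB np Ap Bp.
have A0 : A !=set0 by have [_ [[a Aa _] _]] := Ap _ filterT; exists a.
have B0 : B !=set0 by have [_ [[b Bb _] _]] := Bp _ filterT; exists b.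
pose s x := 1 + dist_to A x + dist_to B x.
have s1 x : 1 <= s x by rewrite /s -addrA lerDl addr_ge0// dist_to_ge0.
have s0 x : 0 < s x by exact: lt_le_trans (s1 x).
(* If [s x < M], both sets have a point within [M] of [x], hence points within 2M of each other,
   which is impossible far out. *)
have s_far (M : R) : exists D : R, forall x, D <= gauge x -> M <= s x.
  move/asymptotically_disjointP : AB => /(_ (M + M))[r hr].
  exists (r + M) => x Dx; rewrite leNgt; apply/negP => sM.
  have dA := dist_to_ge0 A0 x; have dB := dist_to_ge0 B0 x.
  have [|a Aa xa] := @dist_to_lt _ _ A0 x M; first by move: sM; rewrite /s; lra.
  have [|b Bb xb] := @dist_to_lt _ _ B0 x M; first by move: sM; rewrite /s; lra.
  apply: (hr a b) => //.
    by have := gauge_le a x; rewrite metric_sym; lra.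
  by have := metric_triangle a x b; rewrite (metric_sym a x); lra.
have gK x y : `|dist_to A x / s x - dist_to A y / s y| <= 3 * mdist x y / s x.
  by apply: ratio_lipschitz; rewrite ?dist_to_ge0 ?dist_to_lipschitz.
have [|||phi phiE] := @Higson_fun_lipschitz R X (fun x => dist_to A x / s x) 3.
- move=> x; rewrite divr_ge0 ?dist_to_ge0 ?(ltW (s0 x))//= ler_pdivrMr// mul1r.
  by rewrite /s; have := dist_to_ge0 B0 x; lra.
- move=> x y; apply: le_trans (gK x y) _; rewrite ler_pdivrMr//.
  by rewrite ler_peMr// mulr_ge0// mdist_ge0.
- move=> r e e0; have [D hD] := s_far (3 * (`|r| + 1) / e).
  exists D => x y /hD; rewrite ler_pdivrMr// => es xy.
  apply: le_lt_trans (gK x y) _; rewrite ltr_pdivrMr// (mulrC e).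
  apply: lt_le_trans es; rewrite ltr_pM2l//.
  by have := ler_norm r; lra.
(* Where [s] is at least 4, the quotient at a point of [B] is (s - 1)/s, at least 3/4. It is 0 on
   [A], so the two values cannot both be within 1/4 of the coordinate of [p]. *)
have [D hD] := s_far 4.
have e0 : 0 < 1 / 4 :> R by lra.
have [_ [[a Aa <-] /=]] := Ap _ (nbhs_coord p phi e0).
have [_ [[b [Bb Db] <-] /=]] := closure_far D pX np Bp (nbhs_coord p phi e0).
rewrite /Higson_embed !phiE.
have -> : dist_to A a = 0.
  by apply/eqP; rewrite eq_le dist_to_ge0// andbT -(mdistxx a) dist_to_le.
have dBb : dist_to B b = 0.
  by apply/eqP; rewrite eq_le dist_to_ge0// andbT -(mdistxx b) dist_to_le.
have : 3 / 4 <= dist_to A b / s b.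
  by rewrite ler_pdivlMr//; have := hD _ Db; rewrite /s dBb; lra.
rewrite mul0r; move: (set_val (p phi)) (dist_to A b / s b) => c d.
by rewrite !ltr_norml; lra.
Qed.

(* The converse: if [A] and [B] were not asymptotically disjoint, points of [A]
   within bounded distance of [B] would accumulate in the corona, by compactness
   of the cube, and slow oscillation makes the limit adherent to [B] as well. *)
Lemma corona_asymptotically_disjoint X (A B : set X) :
  (forall p : Higson_cube X, Higson_corona p ->
    closure (@Higson_embed R X @` A) p -> closure (@Higson_embed R X @` B) p ->
    False) ->
  asymptotically_disjoint A B.
Proof.
move=> AB; apply/asymptotically_disjointP => M; apply: contrapT => nr.
have {}nr r : exists a b, [/\ A a, B b, r <= gauge a & mdist a b <= M].
  apply: contrapT => h; apply: nr; exists r => a b Aa Bb ra ab.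
  by apply: h; exists a, b.
pose E (r : R) := [set a | [/\ A a, r <= gauge a & exists2 b, B b & mdist a b <= M]].
pose F : set_system (Higson_cube X) :=
  filter_from setT (fun r => @Higson_embed R X @` E r).
have FF : ProperFilter F.
  apply: filter_from_proper.
    apply: filter_from_filter; first by exists 0.
    move=> r t _ _; exists (Num.max r t) => // _ [a [Aa + Ba] <-].
    by rewrite ge_max => /andP[ra ta]; split; exists a.
  move=> r _; have [a [b [Aa Bb ra ab]]] := nr r.
  by exists (Higson_embed a); exists a => //; split => //; exists b.
have [|p [_ clp]] := @compact_cube R X F FF; first exact: filterT.
have Ep r : closure (@Higson_embed R X @` E r) p by move=> W pW; apply: clp => //; exists r.
apply: (AB p).
- apply: Higson_corona_far => r W /(Ep r) [_ [[a [Aa ra _] <-] Wa]].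
  by exists (Higson_embed a); split => //; exists a.
- move=> W /(Ep 0) [_ [[a [Aa ra _] <-] Wa]].
  by exists (Higson_embed a); split => //; exists a.
- move=> W /nbhs_slow [V pV /(_ M)[D hD]].
  have [_ [[a [Aa ra [b Bb ab]] <-] Va]] := Ep D _ pV.
  by exists (Higson_embed b); split; [exists b|exact: hD ab Va].
Qed.

End corona.

(** * Bi-Lipschitz maps and sparse nets *)

Section bilipschitz.
Context {R : realType}.
Implicit Types X Y : metricType R.

Lemma mdist_le_gauge X (x y : X) : mdist x y <= gauge x + gauge y.
Proof.
rewrite /gauge /base_point; case: pselect => [ex|]; last by case; exists x.
by rewrite (metric_sym _ x) metric_triangle.
Qed.

Definition bilipschitz X Y (f : Y -> X) (L : R) : Prop :=
  1 <= L /\ forall x y,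
    mdist (f x) (f y) <= L * mdist x y /\ mdist x y <= L * mdist (f x) (f y).

(** The map may move the base point; [K] absorbs the discrepancy, measured at an arbitrary point
    [a]. *)
Lemma bilipschitz_gauge X Y (f : Y -> X) (L : R) : bilipschitz f L ->
  exists K : R, forall y,
    gauge (f y) <= L * gauge y + K /\ gauge y <= L * gauge (f y) + K.
Proof.
move=> [L1 fL]; have [[a _]|noY] := pselect (exists a : Y, True); last first.
  by exists 0 => y; exfalso; apply: noY; exists y.
have L0 : 0 <= L by lra.
exists (L * gauge a + gauge (f a) + (L * gauge (f a) + gauge a)) => y.
have [h1 h2] := fL a y.
have := gauge_ge0 a; have := gauge_ge0 (f a) => fa0 a0.
have := gauge_le a y; have := gauge_le (f a) (f y) => l1 l2.
have m1 : L * mdist a y <= L * (gauge a + gauge y).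
  by rewrite ler_wpM2l// mdist_le_gauge.
have m2 : L * mdist (f a) (f y) <= L * (gauge (f a) + gauge (f y)).
  by rewrite ler_wpM2l// mdist_le_gauge.
have := mulr_ge0 L0 a0; have := mulr_ge0 L0 fa0; lra.
Qed.

(** * Maps induced on cubes and coronas *)

Section pullback.
Variables (X Y : metricType R) (f : Y -> X) (L : R).
Hypothesis fL : bilipschitz f L.

Lemma bilipschitz_far (r : R) :
  exists D : R, forall y, D <= gauge y -> r <= gauge (f y).
Proof.
have [K hK] := bilipschitz_gauge fL; exists (L * r + K) => y Dy.
have L0 : 0 < L by have := fL.1; lra.
by rewrite -(ler_pM2l L0); have := (hK y).2; lra.
Qed.

Lemma bilipschitz_far_inv (r : R) :
  exists D : R, forall y, D <= gauge (f y) -> r <= gauge y.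
Proof.
have [K hK] := bilipschitz_gauge fL; exists (L * r + K) => y Dy.
have L0 : 0 < L by have := fL.1; lra.
by rewrite -(ler_pM2l L0); have := (hK y).1; lra.
Qed.

Lemma asymptotically_disjoint_image (A B : set Y) :
  asymptotically_disjoint A B -> asymptotically_disjoint (f @` A) (f @` B).
Proof.
move=> /asymptotically_disjointP AB; apply/asymptotically_disjointP => M.
have [r hr] := AB (L * M); have [D hD] := bilipschitz_far_inv r.
exists D => _ _ [a Aa <-] [b Bb <-] /hD ra abM.
apply: (hr a b) => //; apply: le_trans (fL.2 a b).2 _.
by rewrite ler_wpM2l//; have := fL.1; lra.
Qed.

(** Slow oscillation survives the composition because [f] stretches distances by at most [L] and
    sends far points to far points. *)
Lemma pullback_subproof (phi : Higson_fun X) :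
  continuous (sval phi \o f) /\ slowly_oscillating (sval phi \o f).
Proof.
have [L1 fLL] := fL; have L0 : 0 < L by lra.
have [cphi sphi] := svalP phi; split.
  move=> y; apply: continuous_comp; last exact: cphi.
  move=> W /nbhs_ballP[e /= e0 eW]; apply/nbhs_ballP.
  exists (e / L); first by rewrite /= divr_gt0.
  move=> z; rewrite ballEmdist /= ltr_pdivlMr// mulrC => yz; apply: eW.
  by rewrite ballEmdist /=; apply: le_lt_trans yz; exact: (fLL y z).1.
apply/slowly_oscillatingP => r e e0.
have [D hD] := (slowly_oscillatingP _).1 sphi (L * r) e e0.
have [D' hD'] := bilipschitz_far D; exists D' => x y /hD' Dx xy.
by apply: hD => //; apply: le_trans (fLL x y).1 _; rewrite ler_pM2l.
Qed.

Definition Higson_fun_pullback (phi : Higson_fun X) : Higson_fun Y :=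
  exist _ (sval phi \o f) (pullback_subproof phi).

(** The extension of [f] to the cubes: by computation it sends [Higson_embed y] to
    [Higson_embed (f y)]. *)
Definition cube_map (p : Higson_cube Y) : Higson_cube X :=
  fun phi => p (Higson_fun_pullback phi).

Lemma continuous_cube_map : continuous cube_map.
Proof. by apply: continuous_cube => phi; exact: continuous_coord. Qed.

Lemma closure_cube_map (A : set Y) (p : Higson_cube Y) :
  closure (@Higson_embed R Y @` A) p ->
  closure (@Higson_embed R X @` (f @` A)) (cube_map p).
Proof.
move=> Ap W /(@continuous_cube_map p)/Ap [_ [[a Aa <-] Wa]].
by exists (cube_map (Higson_embed a)); split=> //; exists (f a) => //; exists a.
Qed.

Lemma corona_cube_map (p : Higson_cube Y) :
  proper_metric Y -> Higson_corona p -> Higson_corona (cube_map p).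
Proof.
move=> pY np; apply: Higson_corona_far => r.
have [D hD] := bilipschitz_far r.
have := closure_cube_map (closure_far D pY np np.1).
apply: closure_subset => _ [_ [y [_ Dy] <-] <-].
by exists (f y) => //; exact: hD.
Qed.

End pullback.

(** * Separated nets *)

(** Zorn's lemma gives a maximal [t]-separated subset of [P]; a point of [P] at distance at least
    [t] from all of it could be added. *)
Lemma separated_net X (P : set X) (t : R) : 0 < t -> exists M : set X,
  [/\ M `<=` P, forall x y, M x -> M y -> x <> y -> t <= mdist x y &
      forall x, P x -> exists2 y, M y & mdist x y < t].
Proof.
move=> t0.
pose S := [set M : set X | M `<=` P /\
  forall x y, M x -> M y -> x <> y -> t <= mdist x y].
have [|M [[MP Msep] Mmax]] := @Zorn_bigcup X S.
  move=> F FS Ftot; split; first by move=> x [N /FS [NP _] /NP].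
  move=> x y [N FN Nx] [N' FN' N'y].
  have [NN'|N'N] := Ftot _ _ FN FN'.
    by apply: (FS _ FN').2 => //; exact: NN'.
  by apply: (FS _ FN).2 => //; exact: N'N.
exists M; split => // x Px; apply: contrapT => h.
have {}h y : M y -> t <= mdist x y.
  by move=> My; rewrite leNgt; apply/negP => xy; apply: h; exists y.
have nMx : ~ M x by move=> /h; rewrite mdistxx leNgt t0.
apply: (Mmax (M `|` [set x])).
  split; first by move=> y My; left.
  by move=> /(_ x (or_intror erefl)).
split; first by move=> y [/MP//|->].
move=> y z [My|->] [Mz|->] yz //; first exact: Msep.
- by rewrite metric_sym; exact: h.
- exact: h.
Qed.

(* The nets for successive scales are thinned out so that a point kept at one
   level is far from all points of the lower levels. *)
Lemma multiscale_net X (P : nat -> set X) (t : nat -> R) :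
  0 < t 0%N -> {homo t : m n / (m <= n)%N >-> m <= n} ->
  exists (D : set X) (lev : X -> nat),
  [/\ forall x, D x -> P (lev x) x,
      forall x y, D x -> D y -> x <> y -> (lev x <= lev y)%N ->
        t (lev y) <= mdist x y &
      forall n x, P n x -> exists2 y, D y & mdist x y <= n.+1%:R * t n].
Proof.
move=> t00 tmon.
have t_gt0 n : 0 < t n by apply: lt_le_trans t00 _; exact: tmon.
have /choice[M hM] := fun n => separated_net (P n) (t_gt0 n).
(* The distance condition refers to the full nets of lower levels, not only to their kept points, so
   the definition is not recursive. *)
pose kept n x := M n x /\ forall m, (m < n)%N -> forall y, M m y -> t n <= mdist x y.
(* A point may be kept at several levels; [lev] fixes one of them. *)
have /choice[lev levP] : forall x, exists n, (exists m, kept m x) -> kept n x.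
  move=> x; have [[m mx]|h] := pselect (exists m, kept m x); first by exists m.
  by exists 0%N.
exists [set x | exists n, kept n x], lev; split.
- by move=> x /levP [Mx _]; have [MP _ _] := hM (lev x); exact: MP.
- move=> x y /levP [Mx _] /levP [My keepy] xy.
  rewrite leq_eqVlt => /orP[/eqP exy|/keepy h]; last by rewrite metric_sym; exact: h.
  by rewrite -exy; have [_ sep _] := hM (lev x); apply: sep => //; rewrite exy.
(* A net point that is not kept is within [t n] of a point of a lower net. Each such move lowers the
   level, so at most [n] moves of length at most [t n] lead to a kept point; entering the net from
   [P n] is the extra move in [n.+1]. *)
have cover n x : M n x -> exists2 y, (exists m, kept m y) & mdist x y <= n%:R * t n.
  elim/ltn_ind: n x => n IH x Mx.
  have [kx|] := pselect (kept n x).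
    exists x; first by exists n.
    by rewrite mdistxx mulr_ge0// ltW.
  move=> /not_andP[//|] /existsNP[m] /not_implyP[mn] /existsNP[y] /not_implyP[My].
  move=> /negP; rewrite -ltNge => xy.
  have [z kz yz] := IH m mn y My; exists z => //.
  apply: le_trans (metric_triangle x y z) _.
  have tmn : t m <= t n by apply: tmon; exact: ltnW.
  have h1 : m%:R * t m <= m%:R * t n by rewrite ler_wpM2l.
  have h2 : m.+1%:R * t n <= n%:R * t n by rewrite ler_pM2r// ler_nat.
  by move: h2; rewrite -natr1 mulrDl mul1r; lra.
move=> n x Px; have [_ _ net] := hM n.
have [y My xy] := net x Px; have [z kz yz] := cover n y My.
exists z => //; apply: le_trans (metric_triangle x y z) _.
by rewrite -natr1 mulrDl mul1r; lra.
Qed.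

(** A limit point outside [D] would have two distinct points of [D] within t/2 of it. *)
Lemma closed_separated X (D : set X) (t : R) : 0 < t ->
  (forall x y, D x -> D y -> x <> y -> t <= mdist x y) -> closed D.
Proof.
move=> t0 sep p Dp; apply: contrapT => nDp.
have near (r : R) : 0 < r -> exists2 x, D x & mdist p x < r.
  move=> r0; have [x [Dx]] := Dp _ (nbhsx_ballx p r r0).
  by rewrite ballEmdist => px; exists x.
have [|x Dx px] := near (t / 2); first by rewrite divr_gt0.
have px0 : 0 < mdist p x.
  by rewrite mdist_gt0; apply/eqP => px'; apply: nDp; rewrite px'.
have [y Dy py] := near _ px0.
have xy : x <> y by move=> xy; move: py; rewrite xy ltxx.
have := sep x y Dx Dy xy; have := metric_triangle x p y.
by rewrite (metric_sym x p); lra.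
Qed.

End bilipschitz.

(** * Monotonicity of asInd *)

Section subspace_theorem.
Context {R : realType}.
Implicit Types X Y : metricType R.

(** The traces of [A] and [B] lie in open sets that avoid the trace of [C], and disjointness in the
    corona gives asymptotic disjointness. *)
Lemma asymptotic_separator_disjoint X (A B C : set X) :
  asymptotic_separator A B C ->
  asymptotically_disjoint A C /\ asymptotically_disjoint B C.
Proof.
move=> [_ [U1 [U2 [_ _ _ CU [AU BU]]]]].
split; apply: corona_asymptotically_disjoint => p np Sp Cp.
- pose q : set_type (@Higson_corona R X) := exist _ p (mem_set np).
  have : (~` corona_trace C) q by rewrite CU; left; exact: AU.
  exact.
- pose q : set_type (@Higson_corona R X) := exist _ p (mem_set np).
  have : (~` corona_trace C) q by rewrite CU; right; exact: BU.
  exact.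
Qed.

(** * Transport of a separator along a bi-Lipschitz map *)

Section pull_separator.
Variables (X Y : metricType R) (f : Y -> X) (L : R).
Hypotheses (pX : proper_metric X) (pY : proper_metric Y) (fL : bilipschitz f L).
Variables (A B : set Y) (C : set X).
Hypothesis sepC : asymptotic_separator (f @` A) (f @` B) C.

(** The map [h] induced on coronas pulls [U1] and [U2] back. The covering hypothesis puts the
    preimage of the trace of [C] inside the trace of [D], which is then removed from both preimages;
    the disjointness hypotheses keep the traces of [A] and [B] off it. *)
Lemma pull_separator (D : set Y) :
  closed D -> asymptotically_disjoint A D -> asymptotically_disjoint B D ->
  (forall M : R, exists T r : R, forall y c, C c -> mdist (f y) c <= M ->
    r <= gauge y -> exists2 x, D x & mdist y x <= T) ->
  asymptotic_separator A B D.
Proof.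
move=> cD AD BD cover; split => //.
have [_ [U1 [U2 [oU1 oU2 U12 CU [AU BU]]]]] := sepC.
pose h (q : set_type (@Higson_corona R Y)) : set_type (@Higson_corona R X) :=
  exist _ (cube_map fL (set_val q))
    (mem_set (corona_cube_map fL pY (set_valP q))).
have ch : continuous h.
  apply: continuous_comp_initial => q.
  apply: (@continuous_comp _ _ _ set_val (cube_map fL)).
    exact: initial_continuous.
  exact: continuous_cube_map.
have oD : open (~` corona_trace D).
  exists (~` closure (@Higson_embed R Y @` D)) => //.
  exact: closed_openC (@closed_closure _ _).
(* Otherwise a neighbourhood [W] of [q] misses [D]. For [V] as in [nbhs_slow], a far point of [E]
   with image at bounded distance from [C] would be close to a point of [D], which would lie in [W].
   So the image of [E] is asymptotically disjoint from [C], although [h q] is adherent to both. *)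
have hC q : corona_trace C (h q) -> corona_trace D q.
  move=> hCq; apply: contrapT => nDq.
  have [W nW WD] : exists2 W, nbhs (set_val q) W &
      forall y, D y -> ~ W (Higson_embed y).
    apply: contrapT => nW; apply: nDq => W qW; apply: contrapT => DW.
    by apply: nW; exists W => // y Dy Wy; apply: DW; exists (Higson_embed y); split => //; exists y.
  have [V qV hV] := nbhs_slow nW.
  pose E := [set y | V (Higson_embed y)].
  have Eq : closure (@Higson_embed R Y @` E) (set_val q).
    move=> W' qW'; have [_ [[y _ <-] [W'y Vy]]] := (set_valP q).1 _ (filterI qW' qV).
    by exists (Higson_embed y); split=> //; exists y.
  apply: (asymptotically_disjoint_corona pX _ (set_valP (h q)) (closure_cube_map Eq) hCq).
  apply/asymptotically_disjointP => M.
  have [T [r hr]] := cover M; have [s hs] := hV T.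
  have [D' hD'] := bilipschitz_far_inv fL (Num.max r s).
  exists D' => _ c [y Ey <-] Cc /hD'; rewrite ge_max => /andP[ry sy] yc.
  have [x Dx yx] := hr y c Cc yc ry.
  by apply: (WD x Dx); exact: hs yx Ey.
exists (h @^-1` U1 `\` corona_trace D), (h @^-1` U2 `\` corona_trace D).
split.
- by apply: openI => //; move/continuousP : ch => /(_ _ oU1).
- by apply: openI => //; move/continuousP : ch => /(_ _ oU2).
- apply/seteqP; split => // q [[U1q _] [U2q _]].
  by have : (U1 `&` U2) (h q) by []; rewrite U12.
- apply/seteqP; split => [q nDq|q [[]//|[]//]].
  have : (~` corona_trace C) (h q) by move=> /hC.
  by rewrite CU => -[Uq|Uq]; [left|right].
- split=> q Sq; split.
  + by apply: AU; exact: closure_cube_map.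
  + by move=> Dq; exact: (asymptotically_disjoint_corona pY AD (set_valP q) Sq Dq).
  + by apply: BU; exact: closure_cube_map.
  + by move=> Dq; exact: (asymptotically_disjoint_corona pY BD (set_valP q) Sq Dq).
Qed.

Lemma bilipschitz_separator : exists2 D : set Y, asymptotic_separator A B D &
  exists g : set_type D -> set_type C, bilipschitz g (2 * L).
Proof.
have [L1 fLL] := fL; have L0 : 0 < L by lra.
(* [rho M] bounds the gauge of the points of [A] and [B] whose images are within [M] of [C]. *)
have /choice[rho hrho] : forall M : R, exists r : R, forall a c, A a \/ B a ->
    C c -> mdist (f a) c <= M -> gauge a < r.
  move=> M; have [/asymptotically_disjointP dA /asymptotically_disjointP dB] :=
    asymptotic_separator_disjoint sepC.
  have [r1 hr1] := dA M; have [r2 hr2] := dB M.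
  have [r hr] := bilipschitz_far fL (Num.max r1 r2); exists r => a c ABa Cc ac.
  rewrite ltNge; apply/negP => /hr; rewrite ge_max => /andP[ra1 ra2].
  case: ABa => [Aa|Ba]; first by apply: (hr1 (f a) c) => //; exists a.
  by apply: (hr2 (f a) c) => //; exists a.
(* The threshold keeps points of level [n] farther than [n] from [A] and [B]: if [a] is within [n]
   of [y], then [f a] is within Ln + n + 1 of [C], which bounds the gauge of [a] through [rho]. *)
pose P (n : nat) := [set y : Y | (exists2 c, C c & mdist (f y) c <= n.+1%:R) /\
  rho (L * n%:R + n.+1%:R) + n%:R <= gauge y].
(* Two displacements of at most n + 1 add up to at most [t n / (2 * L)], small against the distance
   even after distortion by [L]. *)
pose t (n : nat) : R := 4 * L * n.+1%:R.
have [||D [lev [DP Dsep Dcover]]] := @multiscale_net _ _ P t.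
- by rewrite /t mulr1 mulr_gt0.
- by move=> m n mn; rewrite /t ler_pM2l ?mulr_gt0// ler_nat.
have t4 n : 4 <= t n.
  have h1 : 4 * 1 <= 4 * L by lra.
  by apply: le_trans (_ : 4 * L <= _); [lra|rewrite ler_peMr ?ler1n//; lra].
have cD : closed D.
  apply: (@closed_separated _ _ D 4) => // x y Dx Dy xy.
  have [xy'|/ltnW yx'] := leqP (lev x) (lev y).
    exact: le_trans (t4 _) (Dsep _ _ Dx Dy xy xy').
  by rewrite metric_sym; apply: le_trans (t4 _) (Dsep _ _ Dy Dx (nesym xy) yx').
have farD M : exists r, forall y a, D y -> A a \/ B a -> r <= gauge y ->
    mdist y a <= M -> False.
  exists (rho (L * `|M| + (`|M| + 1)) + `|M|) => y a /DP [[c Cc yc] gy] ABa ry yaM.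
  have ya : mdist y a <= `|M| by apply: le_trans (ler_norm M).
  have gya := gauge_le a y; rewrite metric_sym in gya.
  have fac : mdist (f a) c <= L * mdist y a + (lev y).+1%:R.
    apply: le_trans (metric_triangle _ (f y) _) _; rewrite metric_sym.
    by apply: lerD => //; exact: (fLL y a).1.
  (* Low levels are excluded because [y] is far out, high levels by the threshold in [P]. *)
  have [levM|Mlev] := leP (lev y)%:R `|M|.
    have /(hrho _ _ _ ABa Cc) : mdist (f a) c <= L * `|M| + (`|M| + 1).
      apply: le_trans fac _; apply: lerD; first by rewrite ler_pM2l.
      by rewrite -natr1 lerD2r.
    lra.
  have /(hrho _ _ _ ABa Cc) : mdist (f a) c <= L * (lev y)%:R + (lev y).+1%:R.
    apply: le_trans fac _; rewrite lerD2r ler_pM2l//; lra.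
  lra.
exists D.
  apply: pull_separator => //.
  - apply/asymptotically_disjoint_sym/asymptotically_disjointP => M.
    by have [r hr] := farD M; exists r => y a Dy Aa; apply: hr => //; left.
  - apply/asymptotically_disjoint_sym/asymptotically_disjointP => M.
    by have [r hr] := farD M; exists r => y a Dy Aa; apply: hr => //; right.
  (* As [n] exceeds |M|, every far point with image within [M] of [C] lies in [P n], and the
     covering radius of that level applies. *)
  - move=> M; pose n := Num.bound `|M|.
    exists (n.+1%:R * t n), (rho (L * n%:R + n.+1%:R) + n%:R) => y c Cc yc ry.
    apply: Dcover; split => //; exists c => //; apply: le_trans yc _.
    apply: le_trans (ler_norm M) _; apply: ltW.
    apply: lt_le_trans (archi_boundP (normr_ge0 M)) _.
    by rewrite ler_nat.
have /choice[g hg] : forall y : set_type D, exists c : set_type C,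
    mdist (f (set_val y)) (set_val c) <= (lev (set_val y)).+1%:R.
  move=> y; have [[c Cc yc] _] := DP _ (set_valP y).
  by exists (exist _ c (mem_set Cc)).
exists g; split; first by lra.
have main (x y : set_type D) : (lev (set_val x) <= lev (set_val y))%N ->
    mdist (g x) (g y) <= 2 * L * mdist x y /\
    mdist x y <= 2 * L * mdist (g x) (g y).
  move=> lxy; have [->|xy] := eqVneq x y; first by rewrite !mdistxx mulr0.
  have xy' : set_val x <> set_val y by move/val_inj/eqP; exact/negP.
  have : 4 * L * (lev (set_val y)).+1%:R <= mdist (set_val x) (set_val y).
    exact: (Dsep _ _ (set_valP x) (set_valP y) xy' lxy).
  have := hg x; have := hg y; have := fLL (set_val x) (set_val y).
  have -> : mdist x y = mdist (set_val x) (set_val y) by [].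
  have -> : mdist (g x) (g y) = mdist (set_val (g x)) (set_val (g y)) by [].
  have : (lev (set_val x)).+1%:R <= (lev (set_val y)).+1%:R :> R by rewrite ler_nat.
  have : 1 <= (lev (set_val y)).+1%:R :> R by rewrite ler1n.
  move: (set_val x) (set_val y) (set_val (g x)) (set_val (g y)) => u v gu gv.
  have := metric_triangle gu (f u) gv; have := metric_triangle (f u) (f v) gv.
  have := metric_triangle (f u) gu (f v); have := metric_triangle gu gv (f v).
  rewrite (metric_sym gu (f u)) (metric_sym gv (f v)).
  move: (lev u).+1%:R (lev v).+1%:R => k n.
  move: (mdist gu gv) (mdist (f u) (f v)) (mdist u v) (mdist (f u) gu)
    (mdist (f v) gv) (mdist gu (f v)) (mdist (f u) gv) => dg df d a b c e.
  move=> h1 h2 h3 h4 n1 kn [h5 h6] bn ak h7.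
  have Ln : n <= L * n by rewrite ler_peMl//; lra.
  have d0 : 0 <= d by lra.
  have Ld : d <= L * d by rewrite ler_peMl.
  (* With 4Ln <= d, the first bound is dg <= Ld + 2n <= 2Ld; the second follows from d <= L dg + 2Ln
     <= L dg + d/2. *)
  split; first by lra.
  have : L * df <= L * (dg + 2 * n) by rewrite ler_pM2l//; lra.
  lra.
move=> x y; have [/main//|/ltnW/main] := leqP (lev (set_val x)) (lev (set_val y)).
by rewrite (metric_sym y) (metric_sym (g y)).
Qed.

End pull_separator.

(** The constant doubles on passing to the separators, so the induction keeps [L] general, along
    with the spaces and the map. *)
Lemma asInd_lt_bilipschitz (k : nat) X Y (f : Y -> X) (L : R) :
  proper_metric X -> proper_metric Y -> bilipschitz f L ->
  asInd_lt k X -> asInd_lt k Y.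
Proof.
elim: k X Y f L => [|k IH] X Y f L pX pY fL /=.
  move=> [M hM]; exists (L * M) => x y; apply: le_trans (fL.2 x y).2 _.
  by rewrite ler_wpM2l//; have := fL.1; lra.
move=> indX A B AB.
have [C sC indC] := indX _ _ (asymptotically_disjoint_image fL AB).
have [D sD [g gL]] := bilipschitz_separator pX pY fL sC.
exists D => //; apply: IH gL indC; apply: proper_set_type => //.
- by case: sC.
- by case: sD.
Qed.

(** * From the bounds [asInd_lt] to the value [asInd] *)

Lemma bounded_corona X (p : Higson_cube X) :
  proper_metric X -> bounded_metric X -> ~ Higson_corona p.
Proof.
move=> pX [M hM] np.
have h (x : X) : gauge x <= M.
  have : 0 <= M by apply: le_trans (hM x x); exact: mdist_ge0.
  by rewrite /gauge; case: base_point.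
have [_ [[x [_ /= Mx] _] _]] := closure_far (M + 1) pX np np.1 filterT.
by have := h x; lra.
Qed.

(** For a bounded space the corona is empty, so the empty set separates; in the inductive step the
    same separator serves. *)
Lemma asInd_ltS (k : nat) X : proper_metric X -> asInd_lt k X -> asInd_lt k.+1 X.
Proof.
elim: k X => [|k IH] X pX indX A B AB.
  exists set0; last by exists 0 => x; have := set_valP x.
  split; first exact: closed0.
  have noq (q : set_type (@Higson_corona R X)) : False.
    by exact: (bounded_corona pX indX (set_valP q)).
  exists set0, set0; split; try exact: open0.
  - by rewrite setI0.
  - by apply/seteqP; split => q; have := noq q.
  - by split=> q; have := noq q.
have [C sC indC] := indX A B AB; exists C => //.
by apply: IH => //; apply: proper_set_type => //; case: sC.
Qed.

Lemma asInd_lt_leq (k l : nat) X : proper_metric X -> (k <= l)%N ->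
  asInd_lt k X -> asInd_lt l X.
Proof.
move=> pX kl indk; rewrite -(subnK kl).
by elim: (l - k)%N => // n; exact: asInd_ltS.
Qed.

Lemma asInd_leP X (n : int) :
  asInd_le X n <-> exists2 k : nat, n = k%:Z - 1 & asInd_lt k X.
Proof.
case: n => [n|[|n]]; split => //.
- by move=> h; exists n.+1 => //; rewrite -addn1 PoszD addrK.
- by move=> [k kn]; suff -> : k = n.+1 by []; move: kn; lia.
- by exists 0%N.
- by move=> [k kn]; suff -> : k = 0%N by []; move: kn; lia.
- by move=> [k kn]; exfalso; move: kn; lia.
Qed.

(** Monotonicity in [k] makes the integer picked by [xget] minimal, and the least [m] with
    [asInd_lt m X] shows that the default [+oo] is not taken. *)
Lemma asInd_le_asInd X (n : int) : proper_metric X ->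
  asInd_le X n -> (asInd X <= n%:E)%E.
Proof.
move=> pX /asInd_leP[k -> indk].
have ex : exists k, `[< asInd_lt k X >] by exists k; exact/asboolP.
case: (ex_minnP ex) => m /asboolP indm m_min.
rewrite /asInd; case: xgetP => [_ -> [i [/asInd_leP[j -> indj] ni] <-]|].
  rewrite lee_fin leNgt; apply/negP => kj; apply: ni; apply/asInd_leP.
  exists j.-1; first lia.
  by apply: asInd_lt_leq indk => //; lia.
move=> /(_ (m%:Z - 1)%:E%E) [].
exists (m%:Z - 1) => //; split; first by apply/asInd_leP; exists m.
move=> /asInd_leP[j mj indj].
have /m_min : `[< asInd_lt j X >] by exact/asboolP.
by move: mj; lia.
Qed.

End subspace_theorem.

Theorem theorem2 (R : realType) (X : metricType R) (Y : set X) :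
  proper_metric X -> closed Y ->
  (asInd (set_type Y : metricType R) <= asInd X)%E.
Proof.
move=> pX cY; have pY := proper_set_type pX cY.
rewrite [leRHS]/asInd; case: xgetP => [_ -> [n [Xn _] <-]|_]; last exact: leey.
apply: asInd_le_asInd => //; apply/asInd_leP.
have [k -> indk] := (asInd_leP _ _).1 Xn; exists k => //.
(* The inclusion is isometric, hence the constant 1. *)
apply: (@asInd_lt_bilipschitz _ _ _ _ set_val 1 pX pY _ indk).
by split => // x y; rewrite !mul1r.
Qed.
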